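(* Let $\mathcal{C}$ be a small category with finite limits, equipped with an admissible class $\mathcal{M}$, with associated presheaf $M$. Let $C\in\mathcal{C}$, $f\in M(C)$ and $S_C\in\Omega(C)$. Then one always has $\neg\neg_C(S_C\cdot f)\subseteq\neg\neg_C(S_C)\cdot f$. The converse holds, i.e. $\neg\neg:\Omega\to\Omega$ is an $M$-action preserving map in $\widehat{\mathcal{C}}$, whenever in the category $\mathcal{C}$ any composable pair $(s,t)$ admits a pullback, in the sense that for all arrows $s:D\to E$ and $t:E\to F$ there exist an object $P$ and arrows $k:D\to P$ and $h:P\to F$ such that the square $hk=ts$ is a pullback square (exhibiting $D$ as the pullback of $h$ and $t$). In particular, $\neg\neg:\Omega\to\Omega$ is a $\mathrm{Sub}_{\mathcal{C}}(-)$-action preserving map in $\widehat{\mathcal{C}}$ if $\mathcal{C}$ is cartesian closed.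
   Context: $\widehat{\mathcal{C}}$ is the category of presheaves of sets on $\mathcal{C}$, with subobject classifier $\Omega$: $\Omega(C)$ is the set of sieves on $C$. For an arrow $f$, $D_f$ is its domain and $C_f$ its codomain; $t(C)$ is the maximal sieve on $C$. For arrows $f,g$ with codomain $C$, $f\times g$ denotes their product in the slice category $\mathcal{C}/C$, i.e. the diagonal of the pullback square of $f$ and $g$. An admissible class $\mathcal{M}$ on $\mathcal{C}$ is a family of subobjects (monics) of $\mathcal{C}$ which contains all identities, is closed under composition, and is closed under pullback along arbitrary arrows. It yields a subpresheaf $M$ of $\mathrm{Sub}_{\mathcal{C}}(-):\mathcal{C}^{\mathrm{op}}\to\mathbf{Sets}$ by $M(C)=\mathcal{M}/C$, the set of subobjects of $C$ in $\mathcal{M}$, with arrows acting by pullback. $M$ is an internal commutative monoid with multiplication $f\times g$ and unit $\mathrm{id}_C$ at each $C$, and it acts on $\Omega$ by $$S_C\cdot f=\{h\mid C_h=C,\ f\times h\in S_C\}\qquad (S_C\in\Omega(C),\ f\in M(C)).$$ A map $\phi:\Omega\to\Omega$ in $\widehat{\mathcal{C}}$ is $M$-action preserving if $\phi_C(S_C\cdot f)=\phi_C(S_C)\cdot f$ for all $C$, $S_C\in\Omega(C)$, $f\in M(C)$. The class of all monics is an admissible class, with associated presheaf $\mathrm{Sub}_{\mathcal{C}}(-)$; $\mathrm{Sub}_{\mathcal{C}}(-)$-action preserving refers to this case. Since $\mathcal{C}$ has finite limits, the double negation topology is given by $\neg\neg_C(S_C)=\{f\mid C_f=C,\ \exists g\in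 t(D_f);\ fg\in S_C\}$. *)

(* Defs.v *)
From Stdlib Require Import List ClassicalEpsilon FunctionalExtensionality
  PropExtensionality.

Set Implicit Arguments.
Unset Strict Implicit.
Unset Printing Implicit Defensive.

Record category := Category {
  Ob :> Type;
  Hom : Ob -> Ob -> Type;
  idm : forall x, Hom x x;
  comp : forall x y z, Hom y z -> Hom x y -> Hom x z;
  comp_idl : forall x y (f : Hom x y), comp (idm y) f = f;
  comp_idr : forall x y (f : Hom x y), comp f (idm x) = f;
  comp_assoc : forall x y z w (h : Hom z w) (g : Hom y z) (f : Hom x y),
      comp h (comp g f) = comp (comp h g) f
}.
Arguments Hom {c} _ _.
Arguments idm {c} x.
Arguments comp {c x y z} _ _.

Notation "g ∘ f" := (comp g f) (at level 40, left associativity).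

Section Limits.
Variable C : category.

Definition monic (x y : C) (m : Hom x y) : Prop :=
  forall z (a b : Hom z x), m ∘ a = m ∘ b -> a = b.

Definition iso (x y : C) (i : Hom x y) : Prop :=
  exists j : Hom y x, j ∘ i = idm x /\ i ∘ j = idm y.

(* The square  f ∘ p = g ∘ q  is a pullback square. *)
Definition is_pullback (x y z w : C) (f : Hom x z) (g : Hom y z)
    (p : Hom w x) (q : Hom w y) : Prop :=
  f ∘ p = g ∘ q /\
  forall v (a : Hom v x) (b : Hom v y), f ∘ a = g ∘ b ->
    exists! c : Hom v w, p ∘ c = a /\ q ∘ c = b.

Definition is_terminal (t : C) : Prop :=
  forall x : C, exists! u : Hom x t, True.

Definition is_product (a b p : C) (p1 : Hom p a) (p2 : Hom p b) : Prop :=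
  forall v (f : Hom v a) (g : Hom v b),
    exists! c : Hom v p, p1 ∘ c = f /\ p2 ∘ c = g.

(* ev : e × a -> b  exhibits e as the exponential b^a, where (p1, p2) exhibit
   p as e × a; in the universal property,  m  is  l × a. *)
Definition is_exponential (a b e p : C) (p1 : Hom p e) (p2 : Hom p a)
    (ev : Hom p b) : Prop :=
  is_product p1 p2 /\
  forall v q (q1 : Hom q v) (q2 : Hom q a), is_product q1 q2 ->
  forall g : Hom q b,
    exists! l : Hom v e,
      exists m : Hom q p, p1 ∘ m = l ∘ q1 /\ p2 ∘ m = q2 /\ ev ∘ m = g.

Definition cartesian_closed : Prop :=
  (exists t : C, is_terminal t) /\
  (forall a b : C, exists p (p1 : Hom p a) (p2 : Hom p b), is_product p1 p2) /\
  (forall a b : C, exists e p (p1 : Hom p e) (p2 : Hom p a) (ev : Hom p b),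
      is_exponential p1 p2 ev).

Definition composable_pairs_admit_pullbacks : Prop :=
  forall (D E F : C) (s : Hom D E) (t : Hom E F),
    exists (P : C) (k : Hom D P) (h : Hom P F), is_pullback h t k s.

Record diagram (J : category) := Diagram {
  dob :> J -> C;
  dmap : forall i j, Hom i j -> Hom (dob i) (dob j);
  dmap_id : forall i, dmap (idm i) = idm (dob i);
  dmap_comp : forall i j k (v : Hom j k) (u : Hom i j),
      dmap (v ∘ u) = dmap v ∘ dmap u
}.

Definition is_cone (J : category) (D : diagram J) (l : C)
    (pi : forall i, Hom l (D i)) : Prop :=
  forall i j (u : Hom i j), dmap D u ∘ pi i = pi j.

Definition is_limit (J : category) (D : diagram J) (l : C)
    (pi : forall i, Hom l (D i)) : Prop :=
  is_cone pi /\
  forall v (rho : forall i, Hom v (D i)), is_cone rho ->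
    exists! c : Hom v l, forall i, pi i ∘ c = rho i.

End Limits.

Definition finite_category (J : category) : Prop :=
  (exists s : list J, forall i, In i s) /\
  (forall i j : J, exists s : list (Hom i j), forall u, In u s).

Definition has_finite_limits (C : category) : Prop :=
  forall J : category, finite_category J -> forall D : diagram C J,
    exists (l : C) (pi : forall i, Hom l (D i)), is_limit pi.

Inductive cospan_ob := csl | csr | csm.

Definition cospan_hom (a b : cospan_ob) : Type :=
  match a, b with
  | csl, csl | csr, csr | csm, csm | csl, csm | csr, csm => unit
  | _, _ => Empty_set
  end.

Definition cospan_id (a : cospan_ob) : cospan_hom a a :=
  match a with csl => tt | csr => tt | csm => tt end.

Definition cospan_comp (a b c : cospan_ob) :
  cospan_hom b c -> cospan_hom a b -> cospan_hom a c.
Proof. destruct a, b, c; simpl; intros u v; first [exact tt | contradiction]. Defined.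

Lemma cospan_hom_prop (a b : cospan_ob) (u v : cospan_hom a b) : u = v.
Proof. destruct a, b; simpl in *; destruct u, v; reflexivity. Qed.

Definition cospan_cat : category.
Proof.
refine (@Category cospan_ob cospan_hom cospan_id cospan_comp _ _ _);
  intros; apply cospan_hom_prop.
Defined.

Lemma cospan_finite : finite_category cospan_cat.
Proof.
split.
- exists (csl :: csr :: csm :: nil); intros []; simpl; tauto.
- intros a b.
  destruct a, b; simpl;
    first [exists (tt :: nil); intros []; simpl; tauto | exists nil; intros []].
Qed.

Definition cospan_diagram (C : category) (x y z : C) (f : Hom x z) (g : Hom y z) :
  diagram C cospan_cat.
Proof.
refine (@Diagram C cospan_cat
  (fun a => match a with csl => x | csr => y | csm => z end)
  (fun a b => match a, b return cospan_hom a b ->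
                Hom match a with csl => x | csr => y | csm => z end
                    match b with csl => x | csr => y | csm => z end with
     | csl, csl => fun _ => idm x
     | csr, csr => fun _ => idm y
     | csm, csm => fun _ => idm z
     | csl, csm => fun _ => f
     | csr, csm => fun _ => g
     | _, _ => fun u => match u with end
     end) _ _).
- intros []; reflexivity.
- intros [] [] [] v u; simpl in *; try contradiction;
    rewrite ?comp_idl, ?comp_idr; reflexivity.
Defined.

Lemma has_pullbacks (C : category) (HC : has_finite_limits C)
    (x y z : C) (f : Hom x z) (g : Hom y z) :
  exists (w : C) (p : Hom w x) (q : Hom w y), is_pullback f g p q.
Proof.
destruct (HC cospan_cat cospan_finite (cospan_diagram f g)) as (l & pi & Hc & Hu).
exists l, (pi csl), (pi csr); split.
- pose proof (Hc csl csm tt) as H1; pose proof (Hc csr csm tt) as H2; simpl in *.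
  rewrite H1, H2; reflexivity.
- intros v a b E.
  destruct (Hu v (fun i : cospan_cat => match i return Hom v (cospan_diagram f g i) with
     | csl => a | csr => b | csm => f ∘ a end)) as (c & Hc1 & Hc2).
  + intros [] [] u; simpl in *; try contradiction;
      rewrite ?comp_idl; auto.
  + exists c; split; [split; [exact (Hc1 csl) | exact (Hc1 csr)]|].
    intros d [H1 H2]; apply Hc2; intros []; simpl; auto.
    pose proof (Hc csl csm tt) as H3; simpl in H3.
    rewrite <- H3, <- comp_assoc, H1; reflexivity.
Qed.

Section Pullbacks.
Variable C : category.

Lemma iso_monic (x y : C) (i : Hom x y) : iso i -> monic i.
Proof.
intros (j & H & _) z a b E.
rewrite <- (comp_idl a), <- (comp_idl b), <- H, <- !comp_assoc, E; reflexivity.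
Qed.

Lemma iso_id (x : C) : iso (idm x).
Proof. exists (idm x); rewrite comp_idl; auto. Qed.

Lemma iso_comp (x y z : C) (i : Hom y z) (j : Hom x y) :
  iso i -> iso j -> iso (i ∘ j).
Proof.
intros (i' & A & B) (j' & A' & B'); exists (j' ∘ i'); split.
- rewrite <- comp_assoc, (comp_assoc i'), A, comp_idl; exact A'.
- rewrite <- comp_assoc, (comp_assoc j), B', comp_idl; exact B.
Qed.

Lemma iso_inv (x y : C) (i : Hom x y) :
  iso i -> exists j : Hom y x, iso j /\ j ∘ i = idm x /\ i ∘ j = idm y.
Proof. intros (j & A & B); exists j; split; [exists i|]; auto. Qed.

Lemma pullback_unique (x y z w : C) (f : Hom x z) (g : Hom y z)
    (p : Hom w x) (q : Hom w y) (H : is_pullback f g p q)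
    v (c d : Hom v w) : p ∘ c = p ∘ d -> q ∘ c = q ∘ d -> c = d.
Proof.
intros E1 E2; destruct H as [E U].
destruct (U v (p ∘ c) (q ∘ c)) as (e & _ & He).
- rewrite !comp_assoc, E; reflexivity.
- rewrite <- (He c), <- (He d); auto.
Qed.

Lemma pullback_monic (x y z w : C) (f : Hom x z) (g : Hom y z)
    (p : Hom w x) (q : Hom w y) :
  monic f -> is_pullback f g p q -> monic q.
Proof.
intros Hf H v a b E; apply (pullback_unique H); auto.
apply Hf; rewrite !comp_assoc, (proj1 H), <- !comp_assoc, E; reflexivity.
Qed.

Lemma pullback_iso (x y z w w' : C) (f : Hom x z) (g : Hom y z)
    (p : Hom w x) (q : Hom w y) (p' : Hom w' x) (q' : Hom w' y) :
  is_pullback f g p q -> is_pullback f g p' q' ->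
  exists i : Hom w' w, iso i /\ p' = p ∘ i /\ q' = q ∘ i.
Proof.
intros H H'.
destruct (proj2 H w' p' q' (proj1 H')) as (i & (A & B) & _).
destruct (proj2 H' w p q (proj1 H)) as (j & (A' & B') & _).
exists i; split; [|auto].
exists j; split.
- apply (pullback_unique H'); rewrite comp_assoc, comp_idr, ?A', ?B'; auto.
- apply (pullback_unique H); rewrite comp_assoc, comp_idr, ?A, ?B; auto.
Qed.

Lemma pullback_comp_iso (x y z w x' w' : C) (f : Hom x z) (g : Hom y z)
    (p : Hom w x) (q : Hom w y) (i : Hom x' x) (j : Hom w' w) (p' : Hom w' x') :
  iso i -> iso j -> i ∘ p' = p ∘ j ->
  is_pullback f g p q -> is_pullback (f ∘ i) g p' (q ∘ j).
Proof.
intros Hi Hj E H; split.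
- rewrite <- comp_assoc, E, !comp_assoc, (proj1 H); reflexivity.
- intros v a b E'; rewrite <- comp_assoc in E'.
  destruct (proj2 H v _ _ E') as (c & (A & B) & _).
  destruct (iso_inv Hj) as (j' & _ & J1 & J2).
  exists (j' ∘ c); split; [split|].
  + apply (iso_monic Hi).
    rewrite comp_assoc, E, <- A, <- comp_assoc, (comp_assoc j), J2, comp_idl.
    reflexivity.
  + rewrite <- comp_assoc, (comp_assoc j), J2, comp_idl; exact B.
  + intros d (A' & B'); apply (iso_monic Hj), (pullback_unique H).
    * rewrite comp_assoc with (h := j), J2, comp_idl, A.
      rewrite comp_assoc, <- E, <- comp_assoc, A'; reflexivity.
    * rewrite comp_assoc with (h := j), J2, comp_idl, B, comp_assoc, B'; reflexivity.
Qed.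

Lemma pullback_repr (x y z w x' : C) (f : Hom x z) (g : Hom y z) (i : Hom x' x)
    (p : Hom w x') (q : Hom w y) :
  iso i -> is_pullback (f ∘ i) g p q -> is_pullback f g (i ∘ p) q.
Proof.
intros Hi H; destruct (iso_inv Hi) as (i' & Hi' & A & B).
assert (E : i' ∘ (i ∘ p) = p ∘ idm w).
{ rewrite comp_assoc, A, comp_idl, comp_idr; reflexivity. }
pose proof (pullback_comp_iso Hi' (iso_id w) E H) as K.
rewrite <- comp_assoc, B, !comp_idr in K; exact K.
Qed.

Lemma pullback_precomp (x y z w w' : C) (f : Hom x z) (g : Hom y z)
    (p : Hom w x) (q : Hom w y) (j : Hom w' w) :
  iso j -> is_pullback f g p q -> is_pullback f g (p ∘ j) (q ∘ j).
Proof.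
intros Hj H.
pose proof (pullback_comp_iso (iso_id x) Hj (comp_idl (p ∘ j)) H) as K.
rewrite comp_idr in K; exact K.
Qed.

Lemma pullback_along_id (x y : C) (f : Hom x y) : is_pullback f (idm y) (idm x) f.
Proof.
split; [rewrite comp_idl, comp_idr; reflexivity|].
intros v a b E; rewrite comp_idl in E; exists a; split.
- split; [apply comp_idl | exact E].
- intros c [A _]; rewrite comp_idl in A; auto.
Qed.

Lemma pullback_paste (x y z w y' w' : C) (f : Hom x z) (g : Hom y z)
    (p : Hom w x) (q : Hom w y) (g' : Hom y' y) (p' : Hom w' w) (q' : Hom w' y') :
  is_pullback f g p q -> is_pullback q g' p' q' ->
  is_pullback f (g ∘ g') (p ∘ p') q'.
Proof.
intros H H'; split.
- rewrite comp_assoc, (proj1 H), <- comp_assoc, (proj1 H'), comp_assoc; reflexivity.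
- intros v a b E; rewrite <- comp_assoc in E.
  destruct (proj2 H v _ _ E) as (c & (A & B) & _).
  destruct (proj2 H' v _ _ B) as (d & (A' & B') & _).
  exists d; split; [split; [rewrite <- comp_assoc, A'|]; auto|].
  intros e [A'' B'']; apply (pullback_unique H'); [|rewrite B''; auto].
  apply (pullback_unique H).
  + rewrite A', A, comp_assoc, A''; reflexivity.
  + rewrite A', B, comp_assoc, (proj1 H'), <- comp_assoc, B''; reflexivity.
Qed.

End Pullbacks.

(* f × g in the slice category over z. *)
Section SliceProduct.
Variables (C : category) (HC : has_finite_limits C).
Variables (x y z : C) (f : Hom x z) (g : Hom y z).

Record pullback_square := PullbackSquare {
  pb_ob : C;
  pb_fst : Hom pb_ob x;
  pb_snd : Hom pb_ob y;
  pb_ax : is_pullback f g pb_fst pb_snd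
}.

Lemma pullback_square_inhabited : exists s : pullback_square, True.
Proof.
destruct (has_pullbacks HC f g) as (w & p & q & H).
exists (PullbackSquare H); exact I.
Qed.

Definition chosen_pullback : pullback_square :=
  proj1_sig (constructive_indefinite_description _ pullback_square_inhabited).

Definition times : Hom (pb_ob chosen_pullback) z := f ∘ pb_fst chosen_pullback.

End SliceProduct.
Arguments times {C} HC {x y z} f g.
Arguments chosen_pullback {C} HC {x y z} f g.

Record presheaf (C : category) := Presheaf {
  psh_ob :> C -> Type;
  psh_map : forall x y : C, Hom x y -> psh_ob y -> psh_ob x;
  psh_id : forall (x : C) (s : psh_ob x), psh_map (idm x) s = s;
  psh_comp : forall (x y z : C) (g : Hom y z) (f : Hom x y) (s : psh_ob z),
      psh_map (g ∘ f) s = psh_map f (psh_map g s)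
}.

Record presheaf_map (C : category) (F G : presheaf C) := PresheafMap {
  pm_app :> forall x : C, F x -> G x;
  pm_nat : forall (x y : C) (u : Hom x y) (s : F y),
      pm_app (psh_map u s) = psh_map u (pm_app s)
}.

Lemma prop_irrelevance (P : Prop) (a b : P) : a = b.
Proof.
assert (E : P = True) by (apply propositional_extensionality; tauto).
revert a b; rewrite E; intros [] []; reflexivity.
Qed.

Section Omega.
Variable C : category.

Record sieve (c : C) := Sieve {
  sieve_mem :> forall x : C, Hom x c -> Prop;
  sieve_closed : forall (x y : C) (f : Hom x c) (g : Hom y x),
      sieve_mem f -> sieve_mem (f ∘ g)
}.

Definition sieve_le (c : C) (S T : sieve c) : Prop :=
  forall (x : C) (h : Hom x c), S x h -> T x h.

Lemma sieve_ext (c : C) (S T : sieve c) :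
  (forall (x : C) (h : Hom x c), S x h <-> T x h) -> S = T.
Proof.
destruct S as [S HS], T as [T HT]; simpl; intros E.
assert (ST : S = T).
{ apply functional_extensionality_dep; intros x.
  apply functional_extensionality; intros h.
  apply propositional_extensionality, E. }
subst T; rewrite (prop_irrelevance HS HT); reflexivity.
Qed.

Definition sieve_pull (x y : C) (u : Hom x y) (S : sieve y) : sieve x.
Proof.
refine (@Sieve x (fun z h => S z (u ∘ h)) _).
intros z w f g H; rewrite comp_assoc; apply sieve_closed, H.
Defined.

Definition Omega : presheaf C.
Proof.
refine (@Presheaf C sieve sieve_pull _ _).
- intros x S; apply sieve_ext; intros y h; simpl; rewrite comp_idl; tauto.
- intros x y z g f S; apply sieve_ext; intros w h; simpl.
  rewrite comp_assoc; tauto.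
Defined.

End Omega.
Arguments sieve_le {C c} S T.

Section DoubleNegation.
Variables (C : category) (HC : has_finite_limits C).

Definition double_neg_sieve (c : C) (S : sieve c) : sieve c.
Proof.
refine (@Sieve C c (fun x f => exists (y : C) (g : Hom y x), S y (f ∘ g)) _).
intros x y f k (z & g & H).
destruct (has_pullbacks HC g k) as (w & p & q & E & _).
exists w, q.
rewrite <- comp_assoc, <- E, comp_assoc; apply sieve_closed, H.
Defined.

Definition double_neg : presheaf_map (Omega C) (Omega C).
Proof.
refine (@PresheafMap C (Omega C) (Omega C) double_neg_sieve _).
intros x y u S; apply sieve_ext; intros z h; simpl.
split; intros (w & g & H); exists w, g.
- rewrite <- comp_assoc; exact H.
- rewrite comp_assoc; exact H.
Defined.

(* double_neg is the square of the pseudo-complement on sieves. *)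
Definition neg_sieve (c : C) (S : sieve c) : sieve c.
Proof.
refine (@Sieve C c (fun x f => forall (y : C) (g : Hom y x), ~ S y (f ∘ g)) _).
intros x y f k H z g; rewrite <- comp_assoc; apply H.
Defined.

Lemma double_negE (c : C) (S : Omega C c) :
  double_neg c S = neg_sieve (neg_sieve S).
Proof.
apply sieve_ext; intros x f; simpl; split.
- intros H y k N.
  destruct (sieve_closed (s := double_neg_sieve S) k H) as (z & g & Hg).
  exact (N z g Hg).
- intros H; apply NNPP; intros N; apply (H x (idm x)).
  intros y g Hg; apply N; exists y, g; rewrite comp_idr in Hg; exact Hg.
Qed.

End DoubleNegation.

Section Subobjects.
Variable C : category.

(* A subobject of c is an isomorphism class of monics into c. *)
Record subobject (c : C) := Subobject {
  sub_mem :> forall x : C, Hom x c -> Prop;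
  sub_ax : exists (x : C) (m : Hom x c), monic m /\
      forall (y : C) (g : Hom y c),
        sub_mem g <-> exists i : Hom y x, iso i /\ g = m ∘ i
}.

Lemma subobject_ext (c : C) (U V : subobject c) :
  (forall (x : C) (h : Hom x c), U x h <-> V x h) -> U = V.
Proof.
destruct U as [U HU], V as [V HV]; simpl; intros E.
assert (UV : U = V).
{ apply functional_extensionality_dep; intros x.
  apply functional_extensionality; intros h.
  apply propositional_extensionality, E. }
subst V; rewrite (prop_irrelevance HU HV); reflexivity.
Qed.

Lemma sub_monic (c : C) (U : subobject c) (x : C) (f : Hom x c) :
  U x f -> monic f.
Proof.
destruct (sub_ax U) as (y & m & Hm & E); intros H.
apply E in H; destruct H as (i & Hi & ->).
intros z a b Hab; rewrite <- !comp_assoc in Hab.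
apply (iso_monic Hi), Hm, Hab.
Qed.

Lemma sub_rel (c : C) (U : subobject c) (x y : C) (f : Hom x c) (g : Hom y c) :
  U x f -> (U y g <-> exists i : Hom y x, iso i /\ g = f ∘ i).
Proof.
destruct (sub_ax U) as (z & m & Hm & E); intros H.
apply E in H; destruct H as (i & Hi & ->).
destruct (iso_inv Hi) as (i' & Hi' & A & B).
rewrite E; split; intros (j & Hj & ->).
- exists (i' ∘ j); split; [apply iso_comp; auto|].
  rewrite <- comp_assoc, (comp_assoc i), B, comp_idl; reflexivity.
- exists (i ∘ j); split; [apply iso_comp; auto|].
  rewrite comp_assoc; reflexivity.
Qed.

Lemma sub_inhabited (c : C) (U : subobject c) :
  exists (x : C) (f : Hom x c), U x f.
Proof.
destruct (sub_ax U) as (z & m & Hm & E); exists z, m; apply E.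
exists (idm z); split; [apply iso_id | rewrite comp_idr; reflexivity].
Qed.

(* Closure under every pullback square makes adm_mem invariant under
   isomorphism of monics over c, hence a property of subobjects. *)
Record admissible_class := AdmissibleClass {
  adm_mem : forall x c : C, Hom x c -> Prop;
  adm_monic : forall (x c : C) (f : Hom x c), adm_mem f -> monic f;
  adm_id : forall c : C, adm_mem (idm c);
  adm_comp : forall (x y z : C) (g : Hom y z) (f : Hom x y),
      adm_mem g -> adm_mem f -> adm_mem (g ∘ f);
  adm_pullback : forall (x y z w : C) (f : Hom x z) (g : Hom y z)
      (p : Hom w x) (q : Hom w y),
      is_pullback f g p q -> adm_mem f -> adm_mem q
}.

Definition all_monics : admissible_class.
Proof.
refine (@AdmissibleClass (@monic C) _ _ _ _).
- auto.
- intros c; apply iso_monic, iso_id.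
- intros x y z g f Hg Hf v a b E; rewrite <- !comp_assoc in E; auto.
- intros x y z w f g p q H Hf; apply (pullback_monic Hf H).
Defined.

Record adm_sub (M : admissible_class) (c : C) := AdmSub {
  adm_sub_val :> subobject c;
  adm_sub_ax : forall (x : C) (f : Hom x c), adm_sub_val x f -> adm_mem M f
}.

Lemma adm_sub_ext (M : admissible_class) (c : C) (U V : adm_sub M c) :
  (forall (x : C) (h : Hom x c), U x h <-> V x h) -> U = V.
Proof.
destruct U as [U HU], V as [V HV]; simpl; intros E.
apply subobject_ext in E; subst V.
rewrite (prop_irrelevance HU HV); reflexivity.
Qed.

Hypothesis HC : has_finite_limits C.

Definition sub_pull (x y : C) (u : Hom x y) (U : subobject y) : subobject x.
Proof.
refine (@Subobject x (fun w q => exists (z : C) (f : Hom z y) (p : Hom w z),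
                          U z f /\ is_pullback f u p q) _).
destruct (sub_inhabited U) as (z & f & Hf).
destruct (has_pullbacks HC f u) as (w & p & q & H).
exists w, q; split; [exact (pullback_monic (sub_monic Hf) H)|].
intros v g; split.
- intros (z' & f' & p' & Hf' & H').
  apply (sub_rel f' Hf) in Hf'; destruct Hf' as (i & Hi & ->).
  destruct (pullback_iso H (pullback_repr Hi H')) as (j & Hj & _ & E).
  exists j; auto.
- intros (i & Hi & ->); exists z, f, (p ∘ i); split; [exact Hf|].
  exact (pullback_precomp Hi H).
Defined.

Definition adm_sub_pull (M : admissible_class) (x y : C) (u : Hom x y)
    (U : adm_sub M y) : adm_sub M x.
Proof.
refine (@AdmSub M x (sub_pull u U) _).
intros w q (z & f & p & Hf & H).
exact (adm_pullback H (adm_sub_ax Hf)).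
Defined.

Definition adm_presheaf (M : admissible_class) : presheaf C.
Proof.
refine (@Presheaf C (adm_sub M) (@adm_sub_pull M) _ _).
- intros x U; apply adm_sub_ext; intros w q; simpl; split.
  + intros (z & f & p & Hf & H).
    apply (sub_rel q Hf).
    destruct (pullback_iso (pullback_along_id f) H) as (i & Hi & _ & E).
    exists i; auto.
  + intros Hq; exists w, q, (idm w); split; [exact Hq | apply pullback_along_id].
- intros x y z g f U; apply adm_sub_ext; intros w q; simpl; split.
  + intros (v & m & p & Hm & H).
    destruct (has_pullbacks HC m g) as (v' & p' & q' & H').
    exists v', q'.
    destruct (has_pullbacks HC q' f) as (w' & p'' & q'' & H'').
    destruct (pullback_iso (pullback_paste H' H'') H) as (i & Hi & E1 & E2).
    exists (p'' ∘ i); split.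
    * exists v, m, p'; auto.
    * rewrite E2; exact (pullback_precomp Hi H'').
  + intros (v' & q' & p'' & (v & m & p' & Hm & H') & H'').
    exists v, m, (p' ∘ p''); split; [exact Hm | exact (pullback_paste H' H'')].
Defined.

Lemma times_in_sieve (c x y w : C) (S : sieve c) (f : Hom x c) (h : Hom y c)
    (p : Hom w x) (q : Hom w y) :
  is_pullback f h p q -> (S _ (times HC f h) <-> S w (f ∘ p)).
Proof.
intros H; unfold times; pose proof (pb_ax (chosen_pullback HC f h)) as H'.
destruct (pullback_iso H' H) as (i & _ & Ei & _).
destruct (pullback_iso H H') as (j & _ & Ej & _).
split; intros K.
- rewrite Ei, comp_assoc; apply sieve_closed, K.
- rewrite Ej, comp_assoc; apply sieve_closed, K.
Qed.

(* The choice of the representative f of the subobject U is immaterial: see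
   act_repr. *)
Definition act (M : admissible_class) (c : C) (S : Omega C c)
    (U : adm_presheaf M c) : Omega C c.
Proof.
refine (@Sieve C c (fun y h => exists (x : C) (f : Hom x c),
                        U x f /\ S _ (times HC f h)) _).
intros y z h k (x & f & Hf & H); exists x, f; split; [exact Hf|].
unfold times in *.
set (s := chosen_pullback HC f h) in *.
set (s' := chosen_pullback HC f (h ∘ k)).
destruct (proj2 (pb_ax s) _ (pb_fst s') (k ∘ pb_snd s')) as (e & (E & _) & _).
- rewrite (proj1 (pb_ax s')), comp_assoc; reflexivity.
- rewrite <- E, comp_assoc; apply sieve_closed, H.
Defined.

Lemma act_repr (M : admissible_class) (c : C) (S : Omega C c)
    (U : adm_presheaf M c) (x y : C) (f : Hom x c) (h : Hom y c) :
  adm_sub_val U x f -> (sieve_mem (act S U) h <-> sieve_mem S (times HC f h)).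
Proof.
intros Hf; split; [|intros H; exists x, f; auto].
intros (x' & f' & Hf' & H).
pose proof (proj1 (sub_rel f' Hf) Hf') as (i & Hi & ->).
pose proof (pullback_repr Hi (pb_ax (chosen_pullback HC (f ∘ i) h))) as K.
apply (times_in_sieve S K).
unfold times in H; rewrite comp_assoc; exact H.
Qed.

Definition action_preserving (M : admissible_class)
    (phi : presheaf_map (Omega C) (Omega C)) : Prop :=
  forall (c : C) (S : Omega C c) (f : adm_presheaf M c),
    phi c (act S f) = act (phi c S) f.

End Subobjects.
Arguments all_monics C : clear implicits.
Arguments adm_presheaf {C} HC M.
Arguments act {C} HC {M c} S U.
Arguments action_preserving {C} HC M phi.

(* Main.v *)
Require Import Defs.

(** An arrow of the form [f a] with [f] monic satisfies [f × (f a) = f a].  If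
    [g] witnesses [h ∈ ¬¬S · f], that is [(f × h) g ∈ S], then [(f × h) g] is
    [h k] with [k] the composite of [g] and the projection to the domain of [h],
    and it also factors through [f]; hence [f × (h k) = (f × h) g ∈ S], so [k]
    witnesses [h ∈ ¬¬(S · f)]. *)

Lemma pullback_of_monic_along_factor {C : category} {x z w : C} {f : Hom x z}
    (a : Hom w x) : monic f -> is_pullback f (f ∘ a) a (idm w).
Proof.
intros Hf; split; [rewrite comp_idr; reflexivity|].
intros v b e E; rewrite <- comp_assoc in E; apply Hf in E.
exists e; split; [split; [auto | apply comp_idl]|].
intros d [_ Hd]; rewrite comp_idl in Hd; auto.
Qed.

Section DoubleNegationAction.
Variables (C : category) (HC : has_finite_limits C) (M : admissible_class C).
Variables (c : C) (f : adm_presheaf HC M c) (S : Omega C c).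

(** If [g] witnesses that [h] is in the left side, then [m × (h ∘ g)] lies in [S] and factors
    through [m × h]; the factor is the witness for the right side. *)
Lemma double_neg_act_le :
  sieve_le (double_neg HC c (act HC S f)) (act HC (double_neg HC c S) f).
Proof.
intros y h (z & g & x & m & Hm & H).
exists x, m; split; [exact Hm|].
set (s := chosen_pullback HC m h).
set (s' := chosen_pullback HC m (h ∘ g)).
(* [e] compares the pullback of [m] along [h ∘ g] with that along [h]. *)
destruct (proj2 (pb_ax s) _ (pb_fst s') (g ∘ pb_snd s')) as (e & (E & _) & _).
{ rewrite (proj1 (pb_ax s')), comp_assoc; reflexivity. }
exists (pb_ob s'), e.
unfold times; fold s; rewrite <- comp_assoc, E; exact H.
Qed.

Lemma act_double_neg_le :
  sieve_le (act HC (double_neg HC c S) f) (double_neg HC c (act HC S f)).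
Proof.
intros y h (x & m & Hm & z & g & H).
unfold times in H; set (s := chosen_pullback HC m h) in *.
exists z, (pb_snd s ∘ g), x, m; split; [exact Hm|].
assert (E : h ∘ (pb_snd s ∘ g) = m ∘ (pb_fst s ∘ g)).
{ rewrite !comp_assoc, (proj1 (pb_ax s)); reflexivity. }
rewrite E.
(* Membership in [S] can be tested on any pullback square, so the one with an identity leg replaces
   the chosen one. *)
apply (times_in_sieve HC S (pullback_of_monic_along_factor _ (sub_monic Hm))).
rewrite comp_assoc; exact H.
Qed.

End DoubleNegationAction.

Lemma double_neg_action_preserving (C : category) (HC : has_finite_limits C)
    (M : admissible_class C) : action_preserving HC M (double_neg HC).
Proof.
intros c S f; apply sieve_ext; intros x h; split.
- apply double_neg_act_le.
- apply act_double_neg_le.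
Qed.

Theorem theorem4p7 (C : category) (HC : has_finite_limits C)
    (M : admissible_class C) :
  (forall (c : C) (f : adm_presheaf HC M c) (S : Omega C c),
     sieve_le (double_neg HC c (act HC S f)) (act HC (double_neg HC c S) f))
  /\ (composable_pairs_admit_pullbacks C ->
      action_preserving HC M (double_neg HC))
  /\ (cartesian_closed C ->
      action_preserving HC (all_monics C) (double_neg HC)).
Proof.
split; [|split; intros _; apply double_neg_action_preserving].
intros c f S; apply double_neg_act_le.
Qed.
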